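(* Let $\phi>0$ and $0<\alpha\le\tfrac{1}{2+2\phi}$. For any even $n\in\mathbb N$ (with $n>\phi$), there exists a $(\phi,\alpha)$-expander $G$ on $n$ nodes that is not connected.
   Context: Graphs are finite, simple, undirected and unweighted. For $S\subseteq V$ let $N(S)=\{v\in V:\exists s\in S,\ \{s,v\}\in E\}$ and $\partial S=N(S)\setminus S$. For $\phi\in(0,n)$ and $\alpha\in(0,\tfrac12]$, a graph $G=(V,E)$ with $n$ nodes is a $(\phi,\alpha)$-expander (small-set vertex expander) if $|\partial S|\ge \phi|S|$ for every $S\subseteq V$ with $0<|S|\le\alpha n$. *)

(* Defs.v *)
From HB Require Import structures.
From mathcomp Require Import all_boot all_order all_algebra.
From mathcomp Require Import reals.

Set Implicit Arguments.
Unset Strict Implicit.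
Unset Printing Implicit Defensive.

Import Order.TTheory GRing.Theory Num.Theory.

Local Open Scope ring_scope.

Record sgraph := SGraph {
  vertex :> finType;
  edge : rel vertex;
  edge_sym : symmetric edge;
  edge_irrefl : irreflexive edge }.

Definition neighbourhood (G : sgraph) (S : {set G}) : {set G} :=
  [set v | [exists s in S, edge s v]].

Definition vertex_boundary (G : sgraph) (S : {set G}) : {set G} :=
  neighbourhood S :\: S.

(* The range conditions on phi and alpha, under which alone the notion is
   defined, are part of the predicate. *)
Definition expander (R : realType) (phi alpha : R) (G : sgraph) : Prop :=
  [/\ 0 < phi < #|G|%:R,
      0 < alpha <= 2^-1 &
      forall S : {set G},
        (0 < #|S|)%N -> #|S|%:R <= alpha * #|G|%:R ->
        phi * #|S|%:R <= #|vertex_boundary S|%:R].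

(* The graph with no vertices counts as connected here. *)
Definition connected_graph (G : sgraph) : Prop :=
  forall x y : G, connect (@edge G) x y.

(* Main.v *)
(* Two disjoint cliques on m = n/2 vertices.  A nonempty S meets some clique C,
   and every vertex of C outside S lies in its boundary, which therefore has at
   least m - #|S| elements; the bound on alpha makes this at least phi * #|S|. *)

Require Import Defs.
From HB Require Import structures.
From mathcomp Require Import all_boot all_order all_algebra.
From mathcomp Require Import reals.
From mathcomp Require Import lra.

Set Implicit Arguments.
Unset Strict Implicit.
Unset Printing Implicit Defensive.

Import Order.TTheory GRing.Theory Num.Theory.

Local Open Scope ring_scope.

(** The boolean selects the clique and the ordinal the node inside it. *)
Definition two_cliques_edge (m : nat) : rel (bool * 'I_m) :=
  fun x y => (x.1 == y.1) && (x != y).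

Lemma two_cliques_edge_sym m : symmetric (@two_cliques_edge m).
Proof. by move=> x y; rewrite /two_cliques_edge eq_sym [x == y]eq_sym. Qed.

Lemma two_cliques_edge_irrefl m : irreflexive (@two_cliques_edge m).
Proof. by move=> x; rewrite /two_cliques_edge !eqxx. Qed.

Definition two_cliques (m : nat) : sgraph :=
  SGraph (@two_cliques_edge_sym m) (@two_cliques_edge_irrefl m).

Lemma card_two_cliques m : #|two_cliques m| = m.*2.
Proof. by rewrite card_prod card_bool card_ord mul2n. Qed.

Lemma two_cliques_disconnected m :
  (0 < m)%N -> ~ connected_graph (two_cliques m).
Proof.
move=> m_gt0 /(_ (true, Ordinal m_gt0) (false, Ordinal m_gt0)) true_to_false.
(* Edges preserve the boolean, so no path joins a [true] node to a [false] one. *)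
have side_closed : closed (@edge (two_cliques m)) [pred x | x.1].
  by move=> x y /andP[/eqP xy _]; rewrite !inE xy.
by have := closed_connect side_closed true_to_false; rewrite !inE.
Qed.

(** The additive form avoids truncated subtraction when [S] has more than [m] nodes. *)
Lemma two_cliques_boundary m (S : {set two_cliques m}) :
  (0 < #|S|)%N -> (m <= #|S| + #|vertex_boundary S|)%N.
Proof.
case/card_gt0P=> x xS.
pose C : {set two_cliques m} := [set (x.1, i) | i : 'I_m].
have cardC : #|C| = m by rewrite card_imset ?card_ord // => i j [].
rewrite -[leqLHS]cardC; apply: leq_trans (leq_card_setU S (vertex_boundary S)).
apply/subset_leq_card/subsetP => _ /imsetP[i _ ->].
rewrite !inE; case: (boolP (_ \in S)) => //= yS.
(* The single node [x] of [S] is adjacent to every node of its clique [C] outside [S]. *)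
apply/existsP; exists x; rewrite xS /= /two_cliques_edge /= eqxx /=.
by apply: contraNneq yS => <-.
Qed.

Theorem lemma4p3 (R : realType) (phi alpha : R)
    (phi_gt0 : 0 < phi)
    (alpha_gt0 : 0 < alpha) (alpha_le : alpha <= 1 / (2 + 2 * phi))
    (n : nat) (n_even : ~~ odd n) (phi_lt_n : phi < n%:R) :
  exists G : sgraph,
    [/\ #|G| = n, expander phi alpha G & ~ connected_graph G].
Proof.
have n_gt0 : (0 < n)%N by rewrite -(ltr0n R); apply: lt_trans phi_lt_n.
have nE : n./2.*2 = n by apply: even_halfK.
have alphaM : alpha * (2 + 2 * phi) <= 1.
  by rewrite -ler_pdivlMr //; lra.
exists (two_cliques n./2); split; first by rewrite card_two_cliques.
- split; rewrite ?card_two_cliques ?nE ?phi_gt0 ?alpha_gt0 //=.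
    by nra.
  move=> S S_gt0 S_small.
  have := two_cliques_boundary S_gt0; rewrite -(ler_nat R) natrD => bound.
  have nRE : n%:R = 2 * n./2%:R :> R by rewrite -[in LHS]nE -mul2n natrM.
  have n_ge0 : 0 <= n%:R :> R by [].
  (* Halving this gives [(1 + phi) * #|S| <= n./2], so [phi * #|S|] is at most [n./2 - #|S|], which
     [bound] places below the boundary size. *)
  have : (2 + 2 * phi) * #|S|%:R <= n%:R.
    apply: (@le_trans _ _ ((2 + 2 * phi) * (alpha * n%:R))).
      by rewrite ler_wpM2l //; lra.
    by rewrite mulrA [_ * alpha]mulrC ler_piMl.
  by lra.
(* Both cliques are nonempty because [n] is even and positive. *)
- by apply: two_cliques_disconnected; rewrite -double_gt0 nE.
Qed.
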